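(* Let $G\rightrightarrows Q$ be a Lie groupoid and $L_d:G_2\to\mathbb{R}$ a discrete second-order Lagrangian. If $Z\in\Gamma(A(\mathcal{P}^{\alpha}G))$ is a Noether symmetry of the discrete second-order Lagrangian system determined by $L_d$, with associated function $f\in C^{\infty}(G)$, then the function $F_Z:\Sigma_{L_d}\to\mathbb{R}$ given by $$F_Z(\mu)=\langle\tilde\alpha(\mu),Z(\alpha^{\alpha}(\xi))\rangle+f(\alpha^{\alpha}(\xi))=\langle\tilde\beta(\mu),Z(\beta^{\alpha}(\xi))\rangle+f(\beta^{\alpha}(\xi)),\qquad \xi=\pi_{\mathcal{P}^{\alpha}G}(\mu),$$ is a constant of motion. That is, if $\gamma_{(g_1,g_2)},\ldots,\gamma_{(g_{N-1},g_N)}\in T^*(\mathcal{P}^{\alpha}G)$ satisfy the discrete second-order dynamics, then $$F_Z(\gamma_{(g_k,g_{k+1})})=F_Z(\gamma_{(g_{k+1},g_{k+2})}),\qquad k=1,\ldots,N-2.$$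
   Context: A Lie groupoid $G\rightrightarrows Q$ has source $\alpha$, target $\beta$, identity section $\epsilon$, inversion $i$, and multiplication $gh$ defined on $G_2=\{(g,h)\in G\times G\mid\beta(g)=\alpha(h)\}$. Left and right translations are $\ell_g(h)=gh$, $r_g(h)=hg$. The Lie algebroid $AG\to Q$ has fibre $A_qG=\ker T_{\epsilon(q)}\alpha$; a section $X$ determines the left-invariant vector field $\overleftarrow{X}(g)=T_{\epsilon(\beta(g))}\ell_g(X(\beta(g)))$ and the right-invariant vector field $\overrightarrow{X}(g)=-T_{\epsilon(\alpha(g))}(r_g\circ i)(X(\alpha(g)))$. The same definitions apply to any Lie groupoid. A discrete second-order Lagrangian is a smooth function $L_d:G_2\to\mathbb{R}$. The prolongation of $G$ over $\alpha$ is the Lie groupoid $$\mathcal{P}^{\alpha}G=\{(g,h,r)\in G\times G\times G\mid \alpha(g)=\alpha(h),\ \beta(h)=\alpha(r)\}\rightrightarrows G,$$ with source $\alpha^{\alpha}(g,h,r)=g$, target $\beta^{\alpha}(g,h,r)=r$, multiplication $(g,h,r)(r,h',s)=(g,hh',s)$, identity $g\mapsto(g,\epsilon(\alpha(g)),g)$ and inversion $(g,h,r)\mapsto(r,h^{-1},g)$. Its Lie algebroid is $A(\mathcal{P}^{\alpha}G)\to G$, and $\pi_{\mathcal{P}^{\alpha}G}:T^*(\mathcal{P}^{\alpha}G)\to\mathcal{P}^{\alpha}G$ is the cotangent bundle projection. The cotangent groupoid $T^*(\mathcal{P}^{\alpha}G)\rightrightarrows A^*(\mathcal{P}^{\alpha}G)$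 has source and target given, for $\mu\in T^*_{(g,h,r)}(\mathcal{P}^{\alpha}G)$, by $\tilde\alpha(\mu)\in A_g^*(\mathcal{P}^{\alpha}G)$, $\langle\tilde\alpha(\mu),Z(g)\rangle=\langle\mu,\overrightarrow{Z}(g,h,r)\rangle$, and $\tilde\beta(\mu)\in A_r^*(\mathcal{P}^{\alpha}G)$, $\langle\tilde\beta(\mu),Z(r)\rangle=\langle\mu,\overleftarrow{Z}(g,h,r)\rangle$, for all sections $Z$ of $A(\mathcal{P}^{\alpha}G)$. Let $i_{G_2}:G_2\hookrightarrow\mathcal{P}^{\alpha}G$, $i_{G_2}(g,h)=(g,g,h)$. The Lagrangian submanifold generated by $L_d$ is $\Sigma_{L_d}=\{\mu\in T^*(\mathcal{P}^{\alpha}G)\mid i_{G_2}^*\mu=dL_d\}$ (covectors based at points of $i_{G_2}(G_2)$). Throughout, $\gamma_{(g_k,g_{k+1})}$ denotes an element of $T^*_{(g_k,g_k,g_{k+1})}(\mathcal{P}^{\alpha}G)$ with $(g_k,g_{k+1})\in G_2$. A sequence $\gamma_{(g_1,g_2)},\ldots,\gamma_{(g_{N-1},g_N)}$ satisfies the discrete second-order dynamics if all its elements lie in $\Sigma_{L_d}$ and $\tilde\alpha(\gamma_{(g_k,g_{k+1})})=\tilde\beta(\gamma_{(g_{k-1},g_k)})$ for $k=2,\ldots,N-1$. A section $Z\in\Gamma(A(\mathcal{P}^{\alpha}G))$ is a Noether symmetry of the discrete second-order Lagrangian system determined by $L_d$ if there exists $f\in C^{\infty}(G)$ such that $$\langle\tilde\alpha(\mu),Z(\alpha^{\alpha}(\xi))\rangle+f(\alpha^{\alpha}(\xi))=\langle\tilde\beta(\mu),Z(\beta^{\alpha}(\xi))\rangle+f(\beta^{\alpha}(\xi))$$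 for all $\mu\in\Sigma_{L_d}$, with $\xi=\pi_{\mathcal{P}^{\alpha}G}(\mu)$. *)

(* Defs.v *)
From HB Require Import structures.
From mathcomp Require Import all_boot all_order all_algebra.
From mathcomp Require Import all_classical all_reals topology normedtype derive ring.
Set Implicit Arguments.
Unset Strict Implicit.
Unset Printing Implicit Defensive.
Import Order.TTheory GRing.Theory Num.Theory numFieldNormedType.Exports.
Local Open Scope classical_set_scope.
Local Open Scope ring_scope.

(* Manifolds are presented by their smooth functions.  A differential space   *)
(* (in the sense of Sikorski) is a set M with a family of functions M -> R    *)
(* closed under localisation and under composition with smooth functions on   *)
(* R^n.  A manifold is a differential space that is locally diffeomorphic to  *)
(* R^n, Hausdorff and second countable; the family is then C^oo(M), and an    *)
(* embedded submanifold or a product carries the induced structure.  Hence    *)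
(* fibred products such as G_2 or the prolongation, and the source fibres of  *)
(* a groupoid, have their usual smooth structure, without any choice of       *)
(* charts.                                                                    *)

Section smooth_functions.
Context {R : realType}.

Fixpoint Ck n (k : nat) (f : 'rV[R]_n -> R) : Prop :=
  if k is k'.+1 then (forall x, differentiable f x) /\ (forall v, Ck k' ('D_v f))
  else continuous f.

Definition Cinfty n (f : 'rV[R]_n -> R) := forall k, Ck k f.

Lemma Ck_continuous n k (f : 'rV[R]_n -> R) : Ck k f -> continuous f.
Proof. by case: k => [//|k] [df _] x; exact: differentiable_continuous. Qed.

Lemma CkW n k (f : 'rV[R]_n -> R) : Ck k.+1 f -> Ck k f.
Proof.
elim: k f => [|k IH] f /=; first by move=> [df _] x; exact: differentiable_continuous.
by move=> [df Df]; split=> // v; apply: IH; exact: Df.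
Qed.

Lemma Ck_cst n k (c : R) : Ck k (cst c : 'rV[R]_n -> R).
Proof.
elim: k c => [|k IH] c /=; first by move=> x; exact: cst_continuous.
split=> [x|v]; first exact: differentiable_cst.
have -> : 'D_v (cst c : 'rV[R]_n -> R) = cst 0 by apply/funext => x; rewrite derive_cst.
exact: IH.
Qed.

Lemma CkD n k (f g : 'rV[R]_n -> R) : Ck k f -> Ck k g -> Ck k (f \+ g).
Proof.
elim: k f g => [|k IH] f g /=.
  by move=> cf cg x; exact: (continuousD (cf x) (cg x)).
move=> [df Df] [dg Dg]; split=> [x|v]; first exact: differentiableD.
have -> : 'D_v (f \+ g) = 'D_v f \+ 'D_v g.
  by apply/funext => x; exact: (deriveD (diff_derivable (df x)) (diff_derivable (dg x))).
by apply: IH; [exact: Df|exact: Dg].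
Qed.

Lemma CkM n k (f g : 'rV[R]_n -> R) : Ck k f -> Ck k g -> Ck k (f \* g).
Proof.
elim: k f g => [|k IH] f g Cf Cg.
  by move=> x; exact: (continuousM (Cf x) (Cg x)).
have [df Df] := Cf; have [dg Dg] := Cg.
split=> [x|v]; first exact: differentiableM.
have -> : 'D_v (f \* g) = (f \* 'D_v g) \+ (g \* 'D_v f).
  by apply/funext => x; exact: (deriveM (diff_derivable (df x)) (diff_derivable (dg x))).
by apply: CkD; apply: IH; [exact: CkW|exact: Dg|exact: CkW|exact: Df].
Qed.

Lemma Ck_sum n k (I : Type) (r : seq I) (F : I -> 'rV[R]_n -> R) :
  (forall i, Ck k (F i)) -> Ck k (fun x => \sum_(i <- r) F i x).
Proof.
move=> CF; elim: r => [|i r IH].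
  have -> : (fun x => \sum_(i <- [::]) F i x) = cst 0 by apply/funext => x; rewrite big_nil.
  exact: Ck_cst.
have -> : (fun x => \sum_(j <- i :: r) F j x) = F i \+ (fun x => \sum_(i <- r) F i x).
  by apply/funext => x; rewrite big_cons.
exact: CkD.
Qed.

Lemma coord_linear n (i : 'I_n) : linear (fun x : 'rV[R]_n => x 0 i : R).
Proof. by move=> a u v; rewrite !mxE. Qed.

Lemma Cinfty_coord n (i : 'I_n) : Cinfty (fun x : 'rV[R]_n => x 0 i).
Proof.
have dc (x : 'rV[R]_n) := @differentiable_coord R 1 n x 0 i.
case=> [|k]; first by move=> x; exact: differentiable_continuous.
split=> // v; suff -> : 'D_v (fun x : 'rV[R]_n => x 0 i) = cst (v 0 i) by exact: Ck_cst.
pose f : {linear 'rV[R]_n -> R} := HB.pack (fun x : 'rV[R]_n => x 0 i)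
    (GRing.isLinear.Build _ _ _ _ _ (coord_linear i)).
apply/funext => x; rewrite deriveE//.
by rewrite (@diff_lin _ _ _ f)//; exact: coord_continuous.
Qed.

Lemma cvg_rowmx n (T : Type) (F : set_system T) (FF : Filter F)
    (u : 'I_n -> T -> R) (l : 'I_n -> R) :
  (forall i, u i x @[x --> F] --> l i) ->
  (\row_i u i x : 'rV[R]_n) @[x --> F] --> (\row_i l i : 'rV[R]_n).
Proof.
move=> ul A [P nP PA].
have FP : \forall x \near F, forall i, P ord0 i (u i x).
  by apply: filter_forall => i; apply: (ul i (P ord0 i)); have := nP ord0 i; rewrite mxE.
by apply: filterS FP => x Px; apply: PA => i j /=; rewrite (ord1 i) mxE; exact: Px.
Qed.

Lemma row_sum n (T : Type) (F : 'I_n -> T -> R) (x : T) :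
  \row_i F i x = \sum_i F i x *: delta_mx 0 i :> 'rV[R]_n.
Proof. by rewrite [LHS]row_sum_delta; apply: eq_bigr => i _; rewrite mxE. Qed.

Lemma differentiable_row m n (F : 'I_m -> 'rV[R]_n -> R) x :
  (forall i, differentiable (F i) x) ->
  differentiable (fun x => \row_i F i x : 'rV[R]_m) x.
Proof.
move=> dF.
have -> : (fun x => \row_i F i x : 'rV[R]_m) =
    \sum_i (fun x => F i x *: (delta_mx 0 i : 'rV[R]_m)).
  by apply/funext => y; rewrite row_sum fct_sumE.
by apply: differentiable_sum => i; exact: differentiableZl.
Qed.

Lemma diff_row m n (F : 'I_m -> 'rV[R]_n -> R) x v (i : 'I_m) :
  (forall i, differentiable (F i) x) ->
  ('d (fun x => \row_i F i x : 'rV[R]_m) x v : 'rV[R]_m) 0 i = 'd (F i) x v.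
Proof.
move=> dF.
pose f : {linear 'rV[R]_m -> R} := HB.pack (fun x : 'rV[R]_m => x 0 i)
  (GRing.isLinear.Build _ _ _ _ _ (coord_linear i)).
have fc : continuous f by exact: coord_continuous.
have FE : F i = f \o (fun x => \row_i F i x) by apply/funext => y /=; rewrite mxE.
have df y : differentiable f y by exact: linear_differentiable.
by rewrite [in RHS]FE (diff_comp (differentiable_row dF) (df _)) (diff_lin _ fc).
Qed.

Lemma Ck_comp m n k (psi : 'rV[R]_m -> R) (F : 'I_m -> 'rV[R]_n -> R) :
  Ck k psi -> (forall i, Ck k (F i)) -> Ck k (fun x => psi (\row_i F i x)).
Proof.
elim: k psi F => [|k IH] psi F Cpsi CF.
  move=> x; apply: (@continuous_comp _ _ _ (fun x => \row_i F i x) psi); last exact: Cpsi.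
  exact: (cvg_rowmx (nbhs_filter x) (fun i => CF i x)).
have [dpsi Dpsi] := Cpsi.
have dF i x : differentiable (F i) x by have [] := CF i.
have drow x := @differentiable_row m n F x (dF ^~ x).
split=> [x|v]; first exact: (@differentiable_comp _ _ _ _ _ psi).
have -> : 'D_v (fun x => psi (\row_i F i x)) =
    fun x => \sum_i 'D_v (F i) x * 'D_(delta_mx 0 i) psi (\row_i F i x).
  apply/funext => x.
  rewrite deriveE; last exact: (@differentiable_comp _ _ _ _ _ psi).
  rewrite (@diff_comp _ _ _ _ (fun x => \row_i F i x) psi)//=.
  rewrite [in LHS](row_sum_delta ('d _ x v)) linear_sum; apply: eq_bigr => i _ /=.
  by rewrite linearZ /= !deriveE// diff_row.
apply: Ck_sum => i; apply: (@CkM n k ('D_v (F i))).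
  by have [_] := CF i; exact.
by apply: (IH ('D_(delta_mx 0 i) psi)) => [|j]; [exact: Dpsi|exact: CkW].
Qed.

Lemma Cinfty_comp m n (psi : 'rV[R]_m -> R) (F : 'I_m -> 'rV[R]_n -> R) :
  Cinfty psi -> (forall i, Cinfty (F i)) -> Cinfty (fun x => psi (\row_i F i x)).
Proof. by move=> Cpsi CF k; apply: Ck_comp => // i; exact: CF. Qed.

(* M with the coarsest topology that makes every function of S continuous. *)
Definition coarsest (M : choiceType) (S : set (M -> R)) : Type :=
  sup_topology (fun f : S => Topological.class (initial_topology (val f : M -> R))).
HB.instance Definition _ M S := Topological.on (@coarsest M S).

(* The smallest differential structure containing S: the functions that are  *)
(* locally a smooth function of finitely many elements of S.                 *)
Definition generated (M : choiceType) (S : set (M -> R)) : set (M -> R) :=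
  [set f | forall p : coarsest S, exists n (F : 'I_n -> M -> R) (psi : 'rV[R]_n -> R),
    [/\ forall i, S (F i), Cinfty psi & \forall x \near p, f x = psi (\row_i F i x)]].
End smooth_functions.

Section generated.
Context {R : realType}.

Lemma coarsest_fun_continuous (M : choiceType) (S : set (M -> R)) f :
  S f -> continuous (f : coarsest S -> R).
Proof.
move=> Sf p; pose f' : S := SigSub (mem_set Sf).
have /cvg_sup/(_ f') h : nbhs (p : coarsest S) --> (p : coarsest S) by exact: cvg_id.
by move=> A /(@initial_continuous _ _ (val f') p)/h.
Qed.

Lemma continuous_to_coarsest (T : topologicalType) (M : choiceType)
    (S : set (M -> R)) (phi : T -> M) :
  (forall f, S f -> continuous (f \o phi)) -> continuous (phi : T -> coarsest S).
Proof.
move=> cphi x; apply/cvg_sup => f.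
have := @continuous_comp_initial _ T _ (val f) (phi : T -> initial_topology (val f)).
by apply; apply: cphi; exact: set_mem (valP f).
Qed.

Lemma sub_generated (M : choiceType) (S : set (M -> R)) : S `<=` generated S.
Proof.
move=> f Sf p; exists 1%N, (fun=> f), (fun x => x 0 0); split=> //.
  exact: Cinfty_coord.
by apply: (filterE (F := nbhs (p : coarsest S))) => x; rewrite mxE.
Qed.

Lemma generated_continuous (M : choiceType) (S : set (M -> R)) f :
  generated S f -> continuous (f : coarsest S -> R).
Proof.
move=> Gf p; have [n [F [psi [SF Cpsi fE]]]] := Gf p.
have cpsi : (fun x => psi (\row_i F i x)) @ (nbhs (p : coarsest S)) --> f p.
  rewrite (nbhs_singleton fE).
  apply: (@continuous_comp (coarsest S) _ _ (fun x => \row_i F i x) psi).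
    exact: (cvg_rowmx (nbhs_filter (p : coarsest S)) (fun i => @coarsest_fun_continuous M S (F i) (SF i) p)).
  exact: (Ck_continuous (Cpsi 0%N)).
move=> A /cpsi cA; apply: (@filterS2 _ _ (nbhs_filter (p : coarsest S)) _ _ _ _ fE cA).
by move=> x /= ->.
Qed.

Lemma generated_pullback (M N : choiceType) (S : set (M -> R)) (T : set (N -> R))
    (phi : M -> N) :
  (forall f, T f -> generated S (f \o phi)) ->
  forall f, generated T f -> generated S (f \o phi).
Proof.
move=> Sphi f Tf p.
have cphi : continuous (phi : coarsest S -> coarsest T).
  by apply: continuous_to_coarsest => g /Sphi; exact: generated_continuous.
have [n [F [psi [TF Cpsi fE]]]] := Tf (phi p).
pose loc i := Sphi (F i) (TF i) p.
pose m i := projT1 (cid (loc i)).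
pose H i := projT1 (cid (projT2 (cid (loc i)))).
pose chi i := projT1 (cid (projT2 (cid (projT2 (cid (loc i)))))).
have locE i : [/\ forall j, S (H i j), Cinfty (chi i) &
    \forall x \near (p : coarsest S), F i (phi x) = chi i (\row_j H i j x)].
  exact: (projT2 (cid (projT2 (cid (projT2 (cid (loc i))))))).
pose I := {i : 'I_n & 'I_(m i)}.
exists #|{: I}|, (fun k => H (tag (enum_val k)) (tagged (enum_val k))).
exists (fun y => psi (\row_i chi i (\row_j y 0 (enum_rank (Tagged (fun i => 'I_(m i)) j))))).
split.
- by move=> k; have [+ _ _] := locE (tag (enum_val k)); exact.
- apply: (@Cinfty_comp _ _ _ psi (fun i y => chi i (\row_j y 0 (enum_rank (Tagged (fun i => 'I_(m i)) j))))) => // i.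
  have [_ Cchi _] := locE i.
  apply: (@Cinfty_comp _ _ _ (chi i) (fun j y => y 0 (enum_rank (Tagged (fun i => 'I_(m i)) j)))) => // j.
  exact: Cinfty_coord.
- have nearF : \forall x \near (p : coarsest S), forall i,
      F i (phi x) = chi i (\row_j H i j x).
    by apply: (@filter_forall _ _ _ _ (nbhs_filter (p : coarsest S))) => i; have [] := locE i.
  apply: (@filterS2 _ _ (nbhs_filter (p : coarsest S)) _ _ _ _ (cphi p _ fE) nearF).
  move=> x /= -> Fx.
  congr psi; apply/rowP => i; rewrite !mxE Fx; congr (chi i).
  by apply/rowP => j; rewrite !mxE enum_rankK.
Qed.

Lemma generated_closed (M : choiceType) (S : set (M -> R)) :
  generated (generated S) `<=` generated S.
Proof. by move=> f; exact: (@generated_pullback M M S (generated S) id). Qed.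

End generated.

Record diffSpace (R : realType) := DiffSpace {
  points :> choiceType;
  smooth : set (points -> R);
  smooth_closed : generated smooth `<=` smooth }.
Arguments smooth {R} d.

Section spaces.
Context {R : realType}.
Implicit Types M N P : diffSpace R.

Definition generatedSpace (M : choiceType) (S : set (M -> R)) : diffSpace R :=
  DiffSpace (@generated_closed R M S).

Definition euclidean n : diffSpace R :=
  generatedSpace [set (fun x : 'rV[R]_n => x 0 i) | i in [set: 'I_n]].

Definition subSpace M (A : set M) : diffSpace R :=
  @generatedSpace A [set f \o val | f in smooth M].

Definition prodSpace M N : diffSpace R :=
  @generatedSpace (M * N)%type
    ([set f \o fst | f in smooth M] `|` [set f \o snd | f in smooth N]).

Record smoothMap M N := SmoothMap {
  smap :> M -> N;
  smap_smooth : forall f, smooth N f -> smooth M (f \o smap) }.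

Lemma generated_smooth M (N : choiceType) (S : set (N -> R)) (phi : M -> N) :
  (forall f, S f -> smooth M (f \o phi)) ->
  forall f, smooth (generatedSpace S) f -> smooth M (f \o phi).
Proof.
move=> Sphi f Gf; apply: smooth_closed; apply: (generated_pullback _ Gf) => g Sg.
by apply: sub_generated; exact: Sphi.
Qed.

Lemma comp_smooth M N P (psi : smoothMap N P) (phi : smoothMap M N) f :
  smooth P f -> smooth M (f \o (psi \o phi)).
Proof. by move=> /(smap_smooth psi)/(smap_smooth phi). Qed.
Definition smap_comp M N P (psi : smoothMap N P) (phi : smoothMap M N) :=
  SmoothMap (@comp_smooth M N P psi phi).

Lemma val_smooth M (A : set M) f : smooth M f -> smooth (subSpace A) (f \o val).
Proof. by move=> Mf; apply: sub_generated; exists f. Qed.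
Definition sval M (A : set M) : smoothMap (subSpace A) M := SmoothMap (@val_smooth M A).

Lemma fst_smooth M N f : smooth M f -> smooth (prodSpace M N) (f \o fst).
Proof. by move=> Mf; apply: sub_generated; left; exists f. Qed.
Definition sfst M N : smoothMap (prodSpace M N) M := SmoothMap (@fst_smooth M N).

Lemma snd_smooth M N f : smooth N f -> smooth (prodSpace M N) (f \o snd).
Proof. by move=> Nf; apply: sub_generated; right; exists f. Qed.
Definition ssnd M N : smoothMap (prodSpace M N) N := SmoothMap (@snd_smooth M N).

Lemma const_smooth M N (q : N) f : smooth N f -> smooth M (f \o (fun=> q)).
Proof.
move=> _; apply: smooth_closed => p.
exists 0%N, (fun=> (fun=> 0)), (fun=> f q); split=> [[]//||].
  by move=> k; exact: Ck_cst.
exact: (filterE (F := nbhs (p : coarsest (smooth M)))).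
Qed.
Definition sconst M N (q : N) : smoothMap M N := SmoothMap (@const_smooth M N q).

Definition sid M : smoothMap M M := @SmoothMap M M id (fun f h => h).

Lemma pair_smooth M N P (phi : smoothMap M N) (psi : smoothMap M P) f :
  smooth (prodSpace N P) f -> smooth M (f \o (fun x => (phi x, psi x))).
Proof.
apply: generated_smooth => _ [[g Ng <-]|[g Pg <-]].
- exact: (smap_smooth phi Ng).
- exact: (smap_smooth psi Pg).
Qed.
Definition spair M N P (phi : smoothMap M N) (psi : smoothMap M P) :
  smoothMap M (prodSpace N P) := SmoothMap (@pair_smooth M N P phi psi).

Lemma corestr_smooth M N (A : set N) (phi : smoothMap M N) (h : forall x, A (phi x)) f :
  smooth (subSpace A) f ->
  smooth M (f \o (fun x => SigSub (mem_set (h x)) : A)).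
Proof. by apply: generated_smooth => _ [g Ng <-]; exact: (smap_smooth phi Ng). Qed.
Definition scorestr M N (A : set N) (phi : smoothMap M N) (h : forall x, A (phi x)) :
  smoothMap M (subSpace A) := SmoothMap (corestr_smooth h).

End spaces.

Section smooth_algebra.
Context {R : realType}.
Implicit Types M N : diffSpace R.

Definition smooth_pred M : {pred (M -> R)} := mem (smooth M).

Lemma smooth_comp2 M (op : R -> R -> R) f g :
  Cinfty (fun y : 'rV[R]_2 => op (y 0 0) (y 0 1)) ->
  smooth M f -> smooth M g -> smooth M (fun x => op (f x) (g x)).
Proof.
move=> Cop Mf Mg; apply: smooth_closed => p.
exists 2%N, (fun i : 'I_2 => if i == 0 then f else g), (fun y => op (y 0 0) (y 0 1)).
split=> //; first by move=> i; case: ifP.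
by apply: (filterE (F := nbhs (p : coarsest (smooth M)))) => x; rewrite !mxE.
Qed.

Lemma smooth_subring M : GRing.subring_closed (@smooth_pred M).
Proof.
split=> [|f g|f g]; rewrite !inE.
- apply: smooth_closed => p; exists 0%N, (fun=> cst 0), (cst 1).
  split=> [[]//|k|]; first exact: Ck_cst.
  exact: (filterE (F := nbhs (p : coarsest (smooth M)))).
- apply: (@smooth_comp2 M (fun a b => a - b)) => k.
  apply: (@CkD R 2 k (fun y => y 0 0) (fun y => - y 0 1)); first exact: Cinfty_coord.
  have -> : (fun y : 'rV[R]_2 => - y 0 1) = cst (-1) \* (fun y => y 0 1).
    by apply/funext => y /=; rewrite mulN1r.
  by apply: CkM; [exact: Ck_cst|exact: Cinfty_coord].
- apply: (@smooth_comp2 M *%R) => k.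
  by apply: (@CkM R 2 k (fun y => y 0 0) (fun y => y 0 1)); exact: Cinfty_coord.
Qed.

Lemma smooth_scale M (a : R) : {in @smooth_pred M, forall f, a *: f \in @smooth_pred M}.
Proof.
move=> f; rewrite !inE => Mf; apply: smooth_closed => p.
exists 1%N, (fun=> f), (cst a \* (fun y => y 0 0)); split=> //.
  by move=> k; apply: CkM; [exact: Ck_cst|exact: Cinfty_coord].
by apply: (filterE (F := nbhs (p : coarsest (smooth M)))) => x /=; rewrite !mxE.
Qed.

HB.instance Definition _ M := GRing.isSubringClosed.Build (M -> R) (@smooth_pred M) (@smooth_subring M).
HB.instance Definition _ M := GRing.isScaleClosed.Build R (M -> R) (@smooth_pred M) (@smooth_scale M).

Definition smoothFun M : Type := {f : M -> R | f \in @smooth_pred M}.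
HB.instance Definition _ M := SubChoice.on (smoothFun M).
HB.instance Definition _ M := GRing.SubChoice_isSubPzRing.Build (M -> R) (@smooth_pred M) (smoothFun M) (subringClosedP _).
HB.instance Definition _ M := [SubZmodule_isSubLmodule of smoothFun M by <:].

End smooth_algebra.

Section kernel.
Context {R : realType} {U V : lmodType R}.

Definition kernel_pred (L : {linear U -> V}) : {pred U} := [pred u | L u == 0].

Lemma kernel_submod L : GRing.submod_closed (@kernel_pred L).
Proof.
split=> [|a u v]; rewrite !inE; first by rewrite linear0.
by move=> /eqP Lu /eqP Lv; rewrite linearP Lu Lv scaler0 addr0.
Qed.
HB.instance Definition _ L :=
  GRing.isSubmodClosed.Build R U (kernel_pred L) (kernel_submod L).

Definition kernel (L : {linear U -> V}) : Type := {u : U | u \in kernel_pred L}.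
HB.instance Definition _ L := SubChoice.on (kernel L).
HB.instance Definition _ L := [SubChoice_isSubLmodule of kernel L by <:].
End kernel.

Section tangent.
Context {R : realType}.
Implicit Types M N : diffSpace R.

(* Tangent vectors at p are the derivations at p of the algebra of smooth     *)
(* functions; in particular [val v f] is the value of the differential of f   *)
(* on the tangent vector v.                                                   *)
Definition derivation M (p : M) : {pred (smoothFun M -> R^o)} :=
  mem [set v : smoothFun M -> R^o |
    linear v /\ forall f g, v (f * g) = val f p * v g + v f * val g p].

Lemma derivation_submod M (p : M) : GRing.submod_closed (@derivation M p).
Proof.
split=> [|a v w]; rewrite !inE.
  split=> [b f g|f g].
    by change ((0 : R) = b * 0 + 0); rewrite mulr0 addr0.
  by change ((0 : R) = val f p * 0 + 0 * val g p); rewrite mulr0 mul0r addr0.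
move=> [vl vL] [wl wL]; split=> [b f g|f g].
  change (a * v (b *: f + g) + w (b *: f + g) =
          b * (a * v f + w f) + (a * v g + w g)).
  rewrite vl wl /GRing.scale/=; ring.
change (a * v (f * g) + w (f * g) =
        val f p * (a * v g + w g) + (a * v f + w f) * val g p).
rewrite vL wL; ring.
Qed.
HB.instance Definition _ M (p : M) :=
  GRing.isSubmodClosed.Build R (smoothFun M -> R^o) (@derivation M p) (derivation_submod p).

Definition tangent M (p : M) : Type := {v : smoothFun M -> R^o | v \in derivation p}.
HB.instance Definition _ M (p : M) := SubChoice.on (tangent p).
HB.instance Definition _ M (p : M) := [SubChoice_isSubLmodule of tangent p by <:].

Definition pull M N (phi : smoothMap M N) (f : smoothFun N) : smoothFun M :=
  SigSub (mem_set (smap_smooth phi (set_mem (valP f)))).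

(* [e] is a parameter because base points often agree only propositionally. *)
Section tangent_map.
Variables (M N : diffSpace R) (phi : smoothMap M N) (p : M) (q : N) (e : phi p = q).

Lemma push_derivation (v : tangent p) :
  (fun f : smoothFun N => val v (pull phi f)) \in derivation q.
Proof.
have := valP v; rewrite !inE => -[vl vL]; split=> [a f g|f g].
  rewrite -vl; congr (val v _); exact: val_inj.
have -> : pull phi (f * g) = pull phi f * pull phi g by exact: val_inj.
by rewrite vL -e.
Qed.

Definition tmap_fun (v : tangent p) : tangent q := SigSub (push_derivation v).

Lemma tmap_linear : linear tmap_fun.
Proof. by move=> a v w; apply: val_inj; apply/funext => f. Qed.

HB.instance Definition _ := GRing.isLinear.Build _ _ _ _ tmap_fun tmap_linear.
Definition tmap : {linear tangent p -> tangent q} := tmap_fun.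
End tangent_map.

Definition cotangent M (p : M) := {linear tangent p -> R^o}.

Definition submersion M N (phi : smoothMap M N) :=
  forall p w, exists v : tangent p, tmap (erefl (phi p)) v = w.

Definition diffeomorphic M N := exists (phi : smoothMap M N) (psi : smoothMap N M),
  cancel phi psi /\ cancel psi phi.

(* Every point of an n-manifold has an open neighbourhood diffeomorphic to the *)
(* whole of R^n, so no open subsets of R^n are needed.                         *)
Definition manifold M :=
  let T : topologicalType := coarsest (smooth M) in
  [/\ hausdorff_space T, @second_countable T &
      exists n, forall p : T, exists U : set T,
        [/\ open U, U p & diffeomorphic (@subSpace R M U) (euclidean n)]].

Definition fibre M N (phi : smoothMap M N) q := subSpace [set p | phi p = q].

End tangent.

Definition composable (R : realType) (M N : diffSpace R) (src tgt : smoothMap M N) :=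
  @subSpace R (prodSpace M M) [set x | tgt x.1 = src x.2].

Definition cpair (R : realType) (M N : diffSpace R) (src tgt : smoothMap M N)
  (g h : M) (e : tgt g = src h) : composable src tgt :=
  @SigSub _ _ _ (g, h) (mem_set e).

(* A groupoid all of whose structure maps are smooth; the manifold and         *)
(* submersion requirements are in [lie_groupoid].  [mulg G (cpair e)] is g h   *)
(* when e : tgt g = src h.                                                     *)
Record diffGroupoid (R : realType) := DiffGroupoid {
  base : diffSpace R;
  arrows : diffSpace R;
  src : smoothMap arrows base;
  tgt : smoothMap arrows base;
  idg : smoothMap base arrows;
  invg : smoothMap arrows arrows;
  mulg : smoothMap (composable src tgt) arrows;
  src_id : forall q, src (idg q) = q;
  tgt_id : forall q, tgt (idg q) = q;
  src_inv : forall g, src (invg g) = tgt g;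
  tgt_inv : forall g, tgt (invg g) = src g;
  src_mul : forall g h (e : tgt g = src h), src (mulg (cpair e)) = src g;
  tgt_mul : forall g h (e : tgt g = src h), tgt (mulg (cpair e)) = tgt h;
  mul_id : forall g (e : tgt g = src (idg (tgt g))), mulg (cpair e) = g;
  id_mul : forall g (e : tgt (idg (src g)) = src g), mulg (cpair e) = g;
  mul_inv : forall g (e : tgt g = src (invg g)), mulg (cpair e) = idg (src g);
  inv_mul : forall g (e : tgt (invg g) = src g), mulg (cpair e) = idg (tgt g);
  mul_assoc : forall g h k (gh : tgt g = src h) (hk : tgt h = src k)
    (e : tgt (mulg (cpair gh)) = src k) (e' : tgt g = src (mulg (cpair hk))),
    mulg (cpair e) = mulg (cpair e') }.

Definition lie_groupoid (R : realType) (G : diffGroupoid R) :=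
  [/\ manifold (base G), manifold (arrows G), submersion (src G) & submersion (tgt G)].

Section groupoid_theory.
Context {R : realType} (G : diffGroupoid R).

Definition mul_along (M : diffSpace R) (phi psi : smoothMap M (arrows G))
    (c : forall x, tgt G (phi x) = src G (psi x)) : smoothMap M (arrows G) :=
  smap_comp (mulg G) (@scorestr R M (prodSpace (arrows G) (arrows G))
    [set x | tgt G x.1 = src G x.2] (spair phi psi) c).

Lemma eq_mulg (g g' h h' : arrows G) (e : tgt G g = src G h) (e' : tgt G g' = src G h') :
  g = g' -> h = h' -> mulg G (cpair e) = mulg G (cpair e').
Proof. by move=> gg' hh'; congr (mulg G _); apply: val_inj; rewrite /= gg' hh'. Qed.

Lemma inv_id q : invg G (idg G q) = idg G q.
Proof.
have e : tgt G (idg G q) = src G (invg G (idg G q)) by rewrite src_inv.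
have e' : tgt G (idg G (src G (invg G (idg G q)))) = src G (invg G (idg G q)).
  by rewrite tgt_id.
rewrite -[LHS](id_mul e') -[in RHS](src_id q) -(mul_inv e).
by apply: eq_mulg => //; rewrite src_inv tgt_id.
Qed.

End groupoid_theory.

Section lie_algebroid.
Context {R : realType} (G : diffGroupoid R).
Implicit Types (q : base G) (g : arrows G).

Definition algebroid q :=
  kernel (tmap (src_id q) : {linear tangent (idg G q) -> tangent q}).

(* [X q] is a derivation of the smooth functions on [arrows G]; X is smooth as *)
(* a map into the tangent bundle, whose smooth structure is generated by the   *)
(* functions F and dF with F smooth on [arrows G].                             *)
Record algebroid_section := AlgebroidSection {
  sec :> forall q, algebroid q;
  sec_smooth : forall F : smoothFun (arrows G),
    smooth (base G) (fun q => val (val (sec q)) F) }.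

Definition fibre_pt q : fibre (src G) q :=
  @SigSub _ _ _ (idg G q) (mem_set (src_id q)).

(* [phi] is defined on the source fibre through [idg G q] only, so its tangent *)
(* map acts on [algebroid q], the kernel of the tangent map of [src G], via    *)
(* the identification of this kernel with the tangent space of the fibre.      *)
(* When [src G] is a submersion of manifolds that identification is an         *)
(* isomorphism, and [fibre_tmap] is the unique linear map commuting with it:   *)
(* see [fibre_tmapP].                                                          *)
Definition fibre_incl q : {linear tangent (fibre_pt q) -> tangent (idg G q)} :=
  tmap (erefl : sval _ (fibre_pt q) = idg G q).

Definition is_fibre_tmap (N : diffSpace R) q (phi : smoothMap (fibre (src G) q) N) (n : N)
    (e : phi (fibre_pt q) = n) (L : {linear algebroid q -> tangent n}) :=
  forall (w : tangent (fibre_pt q)) (v : algebroid q),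
    val v = fibre_incl q w -> L v = tmap e w.

Definition fibre_tmap (N : diffSpace R) q (phi : smoothMap (fibre (src G) q) N) (n : N)
    (e : phi (fibre_pt q) = n) : {linear algebroid q -> tangent n} :=
  if pselect (exists L, is_fibre_tmap e L) is left h then projT1 (cid h) else \0.

Lemma fibre_tmapP (N : diffSpace R) q (phi : smoothMap (fibre (src G) q) N) (n : N)
    (e : phi (fibre_pt q) = n) :
  injective (fibre_incl q) -> (forall v : algebroid q, exists w, val v = fibre_incl q w) ->
  is_fibre_tmap e (fibre_tmap e) /\
  forall L, is_fibre_tmap e L -> L =1 fibre_tmap e.
Proof.
move=> inj surj.
have spec : is_fibre_tmap e (fibre_tmap e).
  rewrite /fibre_tmap; case: pselect => [h|]; first exact: (projT2 (cid h)).
  case; pose lift v := projT1 (cid (surj v)).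
  have liftE v : val v = fibre_incl q (lift v) by exact: (projT2 (cid (surj v))).
  have lin : linear (fun v : algebroid q => tmap e (lift v)).
    move=> a v w; rewrite -linearP; congr (tmap e _); apply: inj.
    by rewrite linearP -!liftE.
  pose L : {linear algebroid q -> tangent n} := HB.pack (fun v => tmap e (lift v))
    (GRing.isLinear.Build _ _ _ _ _ lin).
  exists L => w v vE; congr (tmap e _); apply: inj; by rewrite -liftE.
split=> // L LP v; have [w vE] := surj v.
by rewrite (LP w v vE) (spec w v vE).
Qed.

Section translations.
Variable g : arrows G.

Lemma ltrans_comp (h : fibre (src G) (tgt G g)) : tgt G g = src G (val h).
Proof. by rewrite (set_mem (valP h)). Qed.

Definition ltrans : smoothMap (fibre (src G) (tgt G g)) (arrows G) :=
  @mul_along R G _ (sconst _ g) (sval _) ltrans_comp.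

Lemma ltrans_id : ltrans (fibre_pt (tgt G g)) = g.
Proof. exact: (mul_id (ltrans_comp (fibre_pt (tgt G g)))). Qed.

Lemma rtrans_inv_comp (h : fibre (src G) (src G g)) : tgt G (invg G (val h)) = src G g.
Proof. by rewrite tgt_inv (set_mem (valP h)). Qed.

(* The restriction to the source fibre of r_g o i. *)
Definition rtrans_inv : smoothMap (fibre (src G) (src G g)) (arrows G) :=
  @mul_along R G _ (smap_comp (invg G) (sval _)) (sconst _ g) rtrans_inv_comp.

Lemma rtrans_inv_id : rtrans_inv (fibre_pt (src G g)) = g.
Proof.
have e : tgt G (idg G (src G g)) = src G g by rewrite tgt_id.
rewrite -[RHS](id_mul e); apply: (eq_mulg (rtrans_inv_comp (fibre_pt (src G g)))) => //.
exact: inv_id.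
Qed.

Definition left_tmap : {linear algebroid (tgt G g) -> tangent g} := fibre_tmap ltrans_id.

Definition right_tmap : {linear algebroid (src G g) -> tangent g} :=
  -%R \o fibre_tmap rtrans_inv_id.

End translations.

Definition left_invariant (X : algebroid_section) g : tangent g := left_tmap g (X (tgt G g)).
Definition right_invariant (X : algebroid_section) g : tangent g := right_tmap g (X (src G g)).

Definition cotangent_bundle := {g : arrows G & cotangent g}.
Definition cot_proj (mu : cotangent_bundle) : arrows G := projT1 mu.
Definition dual_algebroid := {q : base G & {linear algebroid q -> R^o}}.

Definition pairing (a : dual_algebroid) (X : algebroid_section) : R :=
  projT2 a (X (projT1 a)).

(* Pointwise form of <cot_src mu, X> = <mu, right-invariant field of X> and of *)
(* its analogue for [cot_tgt]; see [cot_srcE] and [cot_tgtE].                  *)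
Definition cot_src (mu : cotangent_bundle) : dual_algebroid :=
  existT (fun q => {linear algebroid q -> R^o}) (src G (cot_proj mu))
    (projT2 mu \o right_tmap (cot_proj mu)).

Definition cot_tgt (mu : cotangent_bundle) : dual_algebroid :=
  existT (fun q => {linear algebroid q -> R^o}) (tgt G (cot_proj mu))
    (projT2 mu \o left_tmap (cot_proj mu)).

Lemma cot_srcE mu X : pairing (cot_src mu) X = projT2 mu (right_invariant X (cot_proj mu)).
Proof. by []. Qed.

Lemma cot_tgtE mu X : pairing (cot_tgt mu) X = projT2 mu (left_invariant X (cot_proj mu)).
Proof. by []. Qed.

End lie_algebroid.

Section prolongation.
Context {R : realType} (G : diffGroupoid R).
Local Notation A := (arrows G).

(* The triple (g, h, r) is encoded as ((g, h), r). *)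
Definition prolong_space : diffSpace R :=
  @subSpace R (prodSpace (prodSpace A A) A)
    [set x | src G x.1.1 = src G x.1.2 /\ tgt G x.1.2 = src G x.2].

Definition prolong1 : smoothMap prolong_space A := smap_comp (sfst _ _) (smap_comp (sfst _ _) (sval _)).
Definition prolong2 : smoothMap prolong_space A := smap_comp (ssnd _ _) (smap_comp (sfst _ _) (sval _)).
Definition prolong3 : smoothMap prolong_space A := smap_comp (ssnd _ _) (sval _).

Lemma prolongP (x : prolong_space) :
  src G (prolong1 x) = src G (prolong2 x) /\ tgt G (prolong2 x) = src G (prolong3 x).
Proof. exact: set_mem (valP x). Qed.

Lemma prolong_inj (x y : prolong_space) : prolong1 x = prolong1 y ->
  prolong2 x = prolong2 y -> prolong3 x = prolong3 y -> x = y.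
Proof.
by case: x y => [[[a b] c] ?] [[[a' b'] c'] ?] /= ? ? ?; apply: val_inj => /=; congr (_, _, _).
Qed.

Definition prolong_along (M : diffSpace R) (u v w : smoothMap M A)
    (c : forall x, src G (u x) = src G (v x) /\ tgt G (v x) = src G (w x)) :
    smoothMap M prolong_space :=
  @scorestr R M (prodSpace (prodSpace A A) A)
    [set x | src G x.1.1 = src G x.1.2 /\ tgt G x.1.2 = src G x.2]
    (spair (spair u v) w) c.

Lemma prolong_id_comp (g : A) :
  src G g = src G (idg G (src G g)) /\ tgt G (idg G (src G g)) = src G g.
Proof. by rewrite src_id tgt_id. Qed.

Definition prolong_id : smoothMap A prolong_space :=
  @prolong_along A (sid A) (smap_comp (idg G) (src G)) (sid A) prolong_id_comp.

Lemma prolong_inv_comp (x : prolong_space) :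
  src G (prolong3 x) = src G (invg G (prolong2 x)) /\
  tgt G (invg G (prolong2 x)) = src G (prolong1 x).
Proof. by have [e1 e2] := prolongP x; rewrite src_inv tgt_inv e1 e2. Qed.

Definition prolong_inv : smoothMap prolong_space prolong_space :=
  @prolong_along _ prolong3 (smap_comp (invg G) prolong2) prolong1 prolong_inv_comp.

Definition prolong_fst : smoothMap (composable prolong1 prolong3) prolong_space :=
  smap_comp (sfst _ _) (sval _).
Definition prolong_snd : smoothMap (composable prolong1 prolong3) prolong_space :=
  smap_comp (ssnd _ _) (sval _).

Lemma prolong_mid_comp (xy : composable prolong1 prolong3) :
  tgt G (prolong2 (prolong_fst xy)) = src G (prolong2 (prolong_snd xy)).
Proof.
have [_ ->] := prolongP (prolong_fst xy); have [<- _] := prolongP (prolong_snd xy).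
by congr (src G _); exact: set_mem (valP xy).
Qed.

Definition prolong_mid : smoothMap (composable prolong1 prolong3) A :=
  @mul_along R G _ (smap_comp prolong2 prolong_fst) (smap_comp prolong2 prolong_snd)
    prolong_mid_comp.

Lemma prolong_mul_comp (xy : composable prolong1 prolong3) :
  src G (prolong1 (prolong_fst xy)) = src G (prolong_mid xy) /\
  tgt G (prolong_mid xy) = src G (prolong3 (prolong_snd xy)).
Proof.
have [e1 _] := prolongP (prolong_fst xy); have [_ e2] := prolongP (prolong_snd xy).
rewrite e1 -e2 (src_mul (prolong_mid_comp xy)) (tgt_mul (prolong_mid_comp xy)); split=> //.
Qed.

Definition prolong_mul : smoothMap (composable prolong1 prolong3) prolong_space :=
  @prolong_along _ (smap_comp prolong1 prolong_fst) prolong_mid (smap_comp prolong3 prolong_snd)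
    prolong_mul_comp.

Lemma prolong_src_mul x y (e : prolong3 x = prolong1 y) :
  prolong1 (prolong_mul (cpair e)) = prolong1 x.
Proof. by []. Qed.

Lemma prolong_tgt_mul x y (e : prolong3 x = prolong1 y) :
  prolong3 (prolong_mul (cpair e)) = prolong3 y.
Proof. by []. Qed.

Lemma prolong_mul_id x (e : prolong3 x = prolong1 (prolong_id (prolong3 x))) :
  prolong_mul (cpair e) = x.
Proof.
apply: prolong_inj => //.
have e' : tgt G (prolong2 x) = src G (idg G (tgt G (prolong2 x))) by rewrite src_id.
rewrite -[RHS](mul_id e'); apply: eq_mulg => //=.
by have [_ <-] := prolongP x.
Qed.

Lemma prolong_id_mul x (e : prolong3 (prolong_id (prolong1 x)) = prolong1 x) :
  prolong_mul (cpair e) = x.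
Proof.
apply: prolong_inj => //.
have e' : tgt G (idg G (src G (prolong2 x))) = src G (prolong2 x) by rewrite tgt_id.
rewrite -[RHS](id_mul e'); apply: eq_mulg => //=.
by have [<- _] := prolongP x.
Qed.

Lemma prolong_mul_inv x (e : prolong3 x = prolong1 (prolong_inv x)) :
  prolong_mul (cpair e) = prolong_id (prolong1 x).
Proof.
apply: prolong_inj => //.
have e' : tgt G (prolong2 x) = src G (invg G (prolong2 x)) by rewrite src_inv.
have [E _] := prolongP x.
by rewrite /= E -(mul_inv e'); apply: eq_mulg.
Qed.

Lemma prolong_inv_mul x (e : prolong3 (prolong_inv x) = prolong1 x) :
  prolong_mul (cpair e) = prolong_id (prolong3 x).
Proof.
apply: prolong_inj => //.
have e' : tgt G (invg G (prolong2 x)) = src G (prolong2 x) by rewrite tgt_inv.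
have [_ E] := prolongP x.
by rewrite /= -E -(inv_mul e'); apply: eq_mulg.
Qed.

Lemma prolong_mul_assoc x y z (xy : prolong3 x = prolong1 y) (yz : prolong3 y = prolong1 z)
    (e : prolong3 (prolong_mul (cpair xy)) = prolong1 z)
    (e' : prolong3 x = prolong1 (prolong_mul (cpair yz))) :
  prolong_mul (cpair e) = prolong_mul (cpair e').
Proof.
apply: prolong_inj => //.
exact: (@mul_assoc R G _ _ _ (prolong_mid_comp (cpair xy)) (prolong_mid_comp (cpair yz))
  (prolong_mid_comp (cpair e)) (prolong_mid_comp (cpair e'))).
Qed.

Definition prolongation : diffGroupoid R :=
  @DiffGroupoid R A prolong_space prolong1 prolong3 prolong_id prolong_inv prolong_mul
    (fun=> erefl) (fun=> erefl) (fun=> erefl) (fun=> erefl)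
    prolong_src_mul prolong_tgt_mul prolong_mul_id prolong_id_mul
    prolong_mul_inv prolong_inv_mul prolong_mul_assoc.

End prolongation.

Section discrete_second_order.
Context {R : realType} (G : diffGroupoid R).
Local Notation A := (arrows G).
Local Notation PG := (prolongation G).

Definition composable_pairs : diffSpace R := composable (src G) (tgt G).
Local Notation G2 := composable_pairs.

Definition G2_fst : smoothMap G2 A := smap_comp (sfst _ _) (sval _).
Definition G2_snd : smoothMap G2 A := smap_comp (ssnd _ _) (sval _).

Lemma G2_incl_comp (x : G2) :
  src G (G2_fst x) = src G (G2_fst x) /\ tgt G (G2_fst x) = src G (G2_snd x).
Proof. by split=> //; exact: set_mem (valP x). Qed.

Definition G2_incl : smoothMap G2 (arrows PG) :=
  @prolong_along R G G2 G2_fst G2_fst G2_snd G2_incl_comp.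

(* [val v L] is dL(v), so the condition reads i^* mu = dL at x. *)
Definition lagrangian_submanifold (L : smoothFun G2) : set (cotangent_bundle PG) :=
  [set mu : cotangent_bundle PG | exists (x : G2) (e : G2_incl x = cot_proj mu),
     forall v : tangent x, projT2 mu (tmap e v) = val v L].

(* The covectors are [gamma k] for 1 <= k < N; other indices are irrelevant. *)
Definition discrete_dynamics (L : smoothFun G2) (N : nat) (g : nat -> A)
    (gamma : nat -> cotangent_bundle PG) :=
  [/\ forall k, (1 <= k < N)%N -> exists e : tgt G (g k) = src G (g k.+1),
        cot_proj (gamma k) = G2_incl (cpair e),
      forall k, (1 <= k < N)%N -> lagrangian_submanifold L (gamma k) &
      forall k, (2 <= k < N)%N -> cot_src (gamma k) = cot_tgt (gamma k.-1)].

Definition noether_symmetry (L : smoothFun G2) (Z : algebroid_section PG) (f : smoothFun A) :=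
  forall mu, lagrangian_submanifold L mu ->
    pairing (cot_src mu) Z + val f (src PG (cot_proj mu)) =
    pairing (cot_tgt mu) Z + val f (tgt PG (cot_proj mu)).

Definition noether_function (L : smoothFun G2) (Z : algebroid_section PG) (f : smoothFun A)
    (mu : lagrangian_submanifold L) : R :=
  pairing (cot_src (val mu)) Z + val f (src PG (cot_proj (val mu))).

Definition constant_of_motion (L : smoothFun G2) (F : lagrangian_submanifold L -> R) :=
  forall N g gamma, discrete_dynamics L N g gamma ->
  forall k, (1 <= k <= N - 2)%N ->
  forall (hk : lagrangian_submanifold L (gamma k))
         (hk1 : lagrangian_submanifold L (gamma k.+1)),
    F (SigSub (mem_set hk)) = F (SigSub (mem_set hk1)).

End discrete_second_order.

(* Main.v *)
Require Import Defs.
From mathcomp Require Import all_boot all_order all_algebra.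
From mathcomp Require Import all_classical all_reals.
Set Implicit Arguments.
Unset Strict Implicit.
Unset Printing Implicit Defensive.
Local Open Scope ring_scope.

(** By the symmetry, [noether_function] at [gamma k] has a target form, determined by
    [cot_tgt (gamma k)] alone. Its source form at [gamma k.+1] is the same expression in
    [cot_src (gamma k.+1)], and the dynamics equate these two momenta. *)

Theorem theorem4p15 (R : realType) (G : diffGroupoid R) (hG : lie_groupoid G)
    (L : smoothFun (composable_pairs G))
    (Z : algebroid_section (prolongation G)) (f : smoothFun (arrows G))
    (hZ : noether_symmetry L Z f) :
  (forall mu : lagrangian_submanifold L,
     noether_function Z f mu =
       pairing (cot_tgt (val mu)) Z + val f (tgt (prolongation G) (cot_proj (val mu)))) /\
  constant_of_motion (noether_function (L := L) Z f).
Proof.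
split=> [mu|N g gamma [_ _ dyn] k /andP[k1 kN] hk hk1].
  exact: hZ (set_mem (valP mu)).
(* Subtraction is truncated, but [1 <= k] rules out [N <= 2], so the matching condition applies at
   [k.+1]. *)
have kN1 : (2 <= k.+1 < N)%N by rewrite ltnS k1 /=; move: k1 kN; clear; case: N => [|[|N]]; rewrite ?subn2 //=; case: k.
have match_momenta := dyn _ kN1.
rewrite /noether_function /= (hZ _ hk).
(* An equality in A^*(P^alpha G) carries the base points, so the f-terms match too. *)
have -> : tgt (prolongation G) (cot_proj (gamma k)) = projT1 (cot_tgt (gamma k)) by [].
by rewrite -match_momenta.
Qed.
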